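(* Let $t_0<T$ be integers, $x_0\in\mathbb{R}^n$ and $\beta\in(0,1]$. Assume that the random variables $w(t_0),\dots,w(T)$ are independent and identically distributed under the probability $\mathbb{P}$, with common marginal distribution $\mu$. Then the stochastic viability kernel $\mathbb{V}\mathrm{iab}_\beta(t_0)$ at confidence level $\beta$ is the section of level $\beta$ of the stochastic viability value function $V$: $$V(t_0,x_0)\ge\beta\iff x_0\in\mathbb{V}\mathrm{iab}_\beta(t_0).$$
   Context: Data. Integers $t_0<T$; state space $\mathbb{X}=\mathbb{R}^n$, control space $\mathbb{U}=\mathbb{R}^p$, disturbance space $\mathbb{W}=\mathbb{R}^q$. The dynamics is $x(t+1)=f(t,x(t),u(t),w(t))$ for $t=t_0,\dots,T-1$, with $f$ taking values in $\mathbb{X}$. For each $(t,x)$, $\mathbb{B}(t,x)\subset\mathbb{U}$ is a nonempty set of admissible controls. For each $t\in\{t_0,\dots,T\}$ and $w$, $\mathbb{A}(t,w)\subset\mathbb{X}$ is a nonempty, possibly uncertain, set of admissible states (the target when $t=T$). Disturbances satisfy $w(t)\in\mathbb{S}(t)\subset\mathbb{W}$. Scenarios are the sequences $w(\cdot)=(w(t_0),\dots,w(T))\in\Omega=\mathbb{S}(t_0)\times\cdots\times\mathbb{S}(T)$, and $\Omega$ carries the trace of the Borel $\sigma$-field and a probability $\mathbb{P}$. The i.i.d. assumption means $\mathbb{P}=\bigotimes_{t=t_0}^{T}\mu$, where $\mu$ is a common marginal distribution. $\mathbb{E}_\mu$ denotes expectation over a single disturbance $w$ with law $\mu$. $\mathbf{1}_A$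 is the indicator function of $A$. Feedbacks. $\mathfrak{U}$ is the set of all measurable maps $\mathfrak{u}:\{t_0,\dots,T-1\}\times\mathbb{X}\to\mathbb{U}$, and $\mathfrak{U}^{\rm ad}=\{\mathfrak{u}\in\mathfrak{U}:\mathfrak{u}(t,x)\in\mathbb{B}(t,x)\ \text{for all }(t,x)\}$. Given $\mathfrak{u}\in\mathfrak{U}$, $w(\cdot)\in\Omega$ and $x_0\in\mathbb{X}$, the state path $x_f[t_0,x_0,\mathfrak{u},w(\cdot)]$ is the sequence $(x(t_0),\dots,x(T))$ with $x(t_0)=x_0$ and $x(t+1)=f(t,x(t),\mathfrak{u}(t,x(t)),w(t))$ for $t=t_0,\dots,T-1$. Stochastic viability kernel. For $\beta\in(0,1]$, $\mathbb{V}\mathrm{iab}_\beta(t_0)$ is the set of $x_0\in\mathbb{X}$ for which there exists $\mathfrak{u}\in\mathfrak{U}^{\rm ad}$ such that $$\mathbb{P}\big(w(\cdot)\in\Omega \mid x(t)\in\mathbb{A}(t,w(t))\text{ for } t=t_0,\dots,T\big)\ge\beta,$$ where $x(t)=x_f[t_0,x_0,\mathfrak{u},w(\cdot)](t)$; the bar means ''such that'' (this is the probability of the set of scenarios, not a conditional probability). Stochastic viability value function. $V$ is defined on $\{t_0,\dots,T\}\times\mathbb{X}$ by the backward induction $$V(T,x)=\mathbb{E}_\mu\big[\mathbf{1}_{\mathbb{A}(T,w)}(x)\big],\qquad V(t,x)=\max_{u\in\mathbb{B}(t,x)}\mathbb{E}_\mu\big[\mathbf{1}_{\mathbb{A}(t,w)}(x)\,V(t+1,f(t,x,u,w))\big],\quad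 t=t_0,\dots,T-1.$$ Standing assumptions. The maximum in the definition of $V$ is attained for every $t$ and $x$. All objects have the appropriate measurability: $f(t,\cdot,\cdot,\cdot)$, the map $(x,w)\mapsto\mathbf{1}_{\mathbb{A}(t,w)}(x)$ and $V(t,\cdot)$ are measurable for every $t$, and there is a measurable feedback $\mathfrak{u}^\star\in\mathfrak{U}$ such that $\mathfrak{u}^\star(t,x)$ attains the maximum defining $V(t,x)$ for every $t\in\{t_0,\dots,T-1\}$ and $x\in\mathbb{X}$. *)

(* Defs.v *)
From HB Require Import structures.
From mathcomp Require Import all_boot all_order all_algebra.
From mathcomp Require Import all_classical all_reals all_analysis.
From mathcomp Require Import measurable_realfun.

Set Implicit Arguments.
Unset Strict Implicit.
Unset Printing Implicit Defensive.
Import Order.TTheory GRing.Theory Num.Theory.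

Local Open Scope classical_set_scope.
Local Open Scope ring_scope.

(* R^n is [n.-tuple R] with its library product sigma-algebra, which is the
   Borel sigma-algebra of R^n.  Data indexed by time are functions of [t : int]
   that are only constrained, and only used, on {t0, ..., T}. *)

(* A sequence (w(t0), ..., w(T)) is a tuple of length T - t0 + 1 (for t0 <= T)
   whose entry i is w(t0 + i). *)
Definition horizon (t0 T : int) : nat := `|T - t0|%N.+1.

Section scenarios.
Context (R : realType) (q : nat) (t0 T : int).
Implicit Type S : int -> set (q.-tuple R).

Definition at_time (w : (horizon t0 T).-tuple (q.-tuple R)) (t : int) :
  q.-tuple R := tnth w (inord `|t - t0|%N).

Definition Omega S : set ((horizon t0 T).-tuple (q.-tuple R)) :=
  [set w | forall t : int, t0 <= t <= T -> S t (at_time w t)].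

(* The set Omega as a type.  The library's measurable types are pointed, hence
   the nonemptiness argument (Omega carries a probability, so it is nonempty). *)
Definition Omega_type S (S0 : Omega S !=set0) : Type :=
  {w : (horizon t0 T).-tuple (q.-tuple R) | w \in Omega S}.

Section pointed.
Context S (S0 : Omega S !=set0).
HB.instance Definition _ := gen_eqMixin (Omega_type S0).
HB.instance Definition _ := gen_choiceMixin (Omega_type S0).
HB.instance Definition _ := isPointed.Build (Omega_type S0)
  (exist _ (projT1 (cid S0)) (mem_set (projT2 (cid S0)))).
End pointed.

Definition Omega_val S (S0 : Omega S !=set0) (w : Omega_type S0) :
  (horizon t0 T).-tuple (q.-tuple R) := sval w.

(* Its measurable sets are the preimages under the inclusion of the measurable
   sets of sequences, i.e. the trace sigma-algebra. *)
Definition scenario S (S0 : Omega S !=set0) :=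
  g_sigma_algebra_preimageType (@Omega_val S S0).

Definition coord S (S0 : Omega S !=set0) (w : scenario S0) (t : int) :
  q.-tuple R := at_time (@Omega_val S S0 w) t.

(* P is the product of T - t0 + 1 copies of mu. *)
Definition iid S (S0 : Omega S !=set0) (P : probability (scenario S0) R)
    (mu : probability (q.-tuple R) R) : Prop :=
  forall E : 'I_(horizon t0 T) -> set (q.-tuple R),
    (forall i, measurable (E i)) ->
    P [set w : scenario S0 |
        forall i : 'I_(horizon t0 T), E i (coord w (t0 + i%:Z))] =
    (\prod_(i < horizon t0 T) mu (E i))%E.

End scenarios.

Arguments Omega {R q} t0 T S _.

Section viability.
Context (R : realType) (n p q : nat) (t0 T : int).
Context (f : int -> n.-tuple R -> p.-tuple R -> q.-tuple R -> n.-tuple R)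
        (B : int -> n.-tuple R -> set (p.-tuple R))
        (A : int -> q.-tuple R -> set (n.-tuple R)).

Definition measurable_feedback (u : int -> n.-tuple R -> p.-tuple R) : Prop :=
  forall t : int, t0 <= t < T -> measurable_fun [set: n.-tuple R] (u t).

Definition admissible_feedback (u : int -> n.-tuple R -> p.-tuple R) : Prop :=
  measurable_feedback u /\ forall (t : int) x, t0 <= t < T -> B t x (u t x).

(* [state_after u w x0 k] is the state at time t0 + k. *)
Fixpoint state_after (u : int -> n.-tuple R -> p.-tuple R)
    (w : int -> q.-tuple R) (x0 : n.-tuple R) (k : nat) : n.-tuple R :=
  if k is k'.+1 then
    let t := t0 + k'%:Z in
    let x := state_after u w x0 k' in
    f t x (u t x) (w t)
  else x0.

Definition state_path u w x0 (t : int) : n.-tuple R :=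
  state_after u w x0 `|t - t0|%N.

Definition viable_scenarios (S : int -> set (q.-tuple R))
    (S0 : Omega t0 T S !=set0) (u : int -> n.-tuple R -> p.-tuple R)
    (x0 : n.-tuple R) : set (scenario S0) :=
  [set w : scenario S0 | forall t : int, t0 <= t <= T ->
     A t (coord w t) (state_path u (coord w) x0 t)].

Definition viability_kernel (S : int -> set (q.-tuple R))
    (S0 : Omega t0 T S !=set0) (P : probability (scenario S0) R) (beta : R) :
    set (n.-tuple R) :=
  [set x0 | exists2 u, admissible_feedback u &
     (beta%:E <= P (@viable_scenarios S S0 u x0))%E].

Section value.
Context (mu : probability (q.-tuple R) R).

(* E_mu [ 1_{A(t,w)}(x) v(f(t,x,u,w)) ] *)
Definition bellman (v : n.-tuple R -> \bar R) (t : int) (x : n.-tuple R)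
    (u : p.-tuple R) : \bar R :=
  (\int[mu]_w ((\1_(A t w) x : R)%:E * v (f t x u w)))%E.

(* [value_to_go k] is V(T - k, .).  Values are taken in \bar R, so that the
   expectation and the supremum (a maximum, under [maximum_attained]) are
   total; all the values lie in [0, 1]. *)
Fixpoint value_to_go (k : nat) (x : n.-tuple R) : \bar R :=
  if k is k'.+1 then
    let t := T - k'.+1%:Z in
    ereal_sup [set bellman (value_to_go k') t x u | u in B t x]
  else 'E_mu[fun w => (\1_(A T w) x : R)]%E.

Definition V (t : int) : n.-tuple R -> \bar R := value_to_go `|T - t|%N.

Definition maximum_attained : Prop :=
  forall (t : int) x, t0 <= t < T ->
    exists2 u, B t x u & bellman (V (t + 1)) t x u = V t x.

Definition optimal_feedback (u : int -> n.-tuple R -> p.-tuple R) : Prop :=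
  forall (t : int) x, t0 <= t < T ->
    B t x (u t x) /\ bellman (V (t + 1)) t x (u t x) = V t x.

End value.
End viability.

(* Main.v *)
(* Under a fixed measurable feedback u, the Bellman recursion without the
   maximum computes the probability of viability: since w(t) is independent of
   the past, it can be redrawn from mu in the integral over scenarios, so that
   E[1_{viable before t} W_u(t, x(t))] does not depend on t, where W_u is the
   value function of u.  At t = t0 it is W_u(t0, x0), after T it is P(viable).
   Backward induction gives W_u <= V for every admissible u, with equality for
   the optimal feedback. *)

Require Import Defs.
From HB Require Import structures.
From mathcomp Require Import all_boot all_order all_algebra.
From mathcomp Require Import all_classical all_reals all_analysis.
From mathcomp Require Import measurable_realfun.
From mathcomp Require Import zify.

Set Implicit Arguments.
Unset Strict Implicit.
Unset Printing Implicit Defensive.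
Import Order.TTheory GRing.Theory Num.Theory.

Local Open Scope classical_set_scope.
Local Open Scope ring_scope.

(** * Probabilities on tuples with independent, identically distributed coordinates *)

Section tuple_measure.
Context d (T : measurableType d) (R : realType) (N : nat).
Local Open Scope ereal_scope.

Definition tuple_box (E : 'I_N -> set T) : set (N.-tuple T) :=
  [set y | forall i, E i (tnth y i)].

Lemma measurable_tuple_box (E : 'I_N -> set T) :
  (forall i, measurable (E i)) -> measurable (tuple_box E).
Proof.
move=> mE; have -> : tuple_box E =
    \bigcap_(i in [set: 'I_N]) ((fun y => tnth y i) @^-1` E i).
  by apply/seteqP; split => y /= yE i; [move=> _|]; exact: yE.
apply: fin_bigcap_measurable => // i _.
by rewrite -[X in measurable X]setTI; exact: measurable_tnth.
Qed.

(** Uniqueness of measures on a generating pi-system: boxes are stable under intersection, and they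
    generate the product sigma-algebra. The constant exhausting sequence [setT] suffices because
    [m1] is finite. *)
Lemma eq_measure_tuple_box (m1 m2 : {measure set (N.-tuple T) -> \bar R}) :
  m1 setT < +oo ->
  (forall E : 'I_N -> set T, (forall i, measurable (E i)) ->
    m1 (tuple_box E) = m2 (tuple_box E)) ->
  forall X, measurable X -> m1 X = m2 X.
Proof.
move=> m1oo m12.
pose G := [set tuple_box E | E in [set E : 'I_N -> set T |
  forall i, measurable (E i)]].
have boxT : tuple_box (fun=> setT) = setT by apply/seteqP; split.
have Gm : G `<=` measurable.
  by move=> _ [E mE <-]; exact: measurable_tuple_box.
have GT : G setT by exists (fun=> setT) => // i; exact: measurableT.
move=> X mX.
apply: (@g_sigma_algebra_measure_unique _ R _ G Gm (fun=> setT)) => //.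
- by apply/seteqP; split => // y _; exists 0%N.
- move=> _ _ [E mE <-] [F mF <-]; exists (fun i => E i `&` F i).
    by move=> i; exact: measurableI.
  apply/seteqP; split => y /=.
    by move=> EF; split => i; case: (EF i).
  by move=> [yE yF] i; split.
- by move=> _ [E mE <-]; exact: m12.
- apply: smallest_sub mX; first exact: smallest_sigma_algebra.
  apply: (big_ind (fun Y => Y `<=` <<s G >>)) => //.
    by move=> Y Z YG ZG A [/YG|/ZG].
  move=> i _ _ [C mC <-]; apply: sub_sigma_algebra.
  (* A generating cylinder is a box all of whose sides but one are the whole space. *)
  exists (fun j => if j == i then C else setT).
    by move=> j; case: ifP => // _; exact: measurableT.
  rewrite setTI; apply/seteqP; split => y /=.
    by move=> /(_ i); rewrite eqxx.
  by move=> yC j; case: eqP => // ->.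
Qed.

Definition set_tnth (y : N.-tuple T) (i : 'I_N) (w : T) : N.-tuple T :=
  [tuple if j == i then w else tnth y j | j < N].

Lemma tnth_set_tnth y i w j :
  tnth (set_tnth y i w) j = if j == i then w else tnth y j.
Proof. by rewrite tnth_mktuple. Qed.

Lemma measurable_set_tnth i :
  measurable_fun setT (fun z : N.-tuple T * T => set_tnth z.1 i z.2).
Proof.
apply/measurable_fun_tnthP => j.
rewrite (_ : _ \o _ = if j == i then snd else (fun z => tnth z.1 j)).
  case: ifP => _ //.
  by apply: (measurableT_comp (measurable_tnth j)); exact: measurable_fst.
by apply/funext => z /=; rewrite tnth_set_tnth; case: ifP.
Qed.

Lemma preimage_set_tnth_box (E : 'I_N -> set T) i :
  (fun z : N.-tuple T * T => set_tnth z.1 i z.2) @^-1` tuple_box E =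
  tuple_box (fun j => if j == i then setT else E j) `*` E i.
Proof.
apply/seteqP; split => -[y w] /=.
  move=> yE; split=> [j|]; last by have := yE i; rewrite tnth_set_tnth eqxx.
  by have := yE j; rewrite tnth_set_tnth; case: ifP.
move=> [yE wE] j; rewrite tnth_set_tnth; have := yE j.
by case: eqP => // ->.
Qed.

Section redraw.
Context (nu : probability (N.-tuple T) R) (mu : probability T R).
Context (nuE : forall E : 'I_N -> set T, (forall i, measurable (E i)) ->
  nu (tuple_box E) = \prod_(i < N) mu (E i)).

(** Overwriting frees coordinate i of the tuple, whose factor becomes [mu setT], that is 1; the
    missing factor [mu (E i)] comes back from the fresh draw. *)
Lemma product_set_tnth_box (E : 'I_N -> set T) i :
  (forall i, measurable (E i)) ->
  nu (tuple_box E) = (nu \x mu)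
    ((fun z : N.-tuple T * T => set_tnth z.1 i z.2) @^-1` tuple_box E).
Proof.
move=> mE; rewrite preimage_set_tnth_box.
have mE' (j : 'I_N) : measurable (if j == i then setT else E j) by case: ifP.
rewrite product_measure1E//; last exact: measurable_tuple_box.
transitivity (nu (tuple_box (fun j => if j == i then setT else E j)) *
  mu (E i)); last by [].
rewrite (nuE mE) (nuE mE') (bigD1 i)// [in RHS](bigD1 i)//= eqxx.
rewrite (probability_setT mu) mul1e.
by rewrite muleC; congr (_ * _); apply: eq_bigr => j /negbTE ->.
Qed.

(** The image of [nu \x mu] under overwriting is [nu], since the two agree on boxes; Tonelli then
    splits the integral. This is the form in which independence enters the dynamic programming
    argument. *)
Lemma integral_set_tnth (g : N.-tuple T -> \bar R) (i : 'I_N) :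
  measurable_fun setT g -> (forall y, 0 <= g y) ->
  \int[nu]_y g y = \int[nu]_y \int[mu]_w g (set_tnth y i w).
Proof.
move=> mg g0.
pose s := (fun z : N.-tuple T * T => set_tnth z.1 i z.2).
have ms : measurable_fun setT s := measurable_set_tnth i.
have mgs : measurable_fun setT (g \o s) by exact: measurableT_comp.
have -> : \int[nu]_y \int[mu]_w g (set_tnth y i w) =
    \int[nu]_y fubini_F mu (g \o s) y by [].
rewrite -fubini_tonelli1//; last by move=> z; exact: g0.
have -> : \int[nu \x mu]_z (g \o s) z = \int[pushforward (nu \x mu) s]_y g y.
  by rewrite ge0_integral_pushforward// preimage_setT.
apply: eq_measure_integral => X mX _.
apply: eq_measure_tuple_box mX => [|E mE].
  by rewrite [X in X < _]probability_setT ltry.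
exact: product_set_tnth_box.
Qed.

End redraw.
End tuple_measure.

(** * The value function of a fixed feedback *)

Section feedback.
Context (R : realType) (n p q : nat) (t0 T : int).
Context (t0T : t0 <= T).
Context (f : int -> n.-tuple R -> p.-tuple R -> q.-tuple R -> n.-tuple R)
        (B : int -> n.-tuple R -> set (p.-tuple R))
        (A : int -> q.-tuple R -> set (n.-tuple R)).
Context (mu : probability (q.-tuple R) R).
Context (f_meas : forall t : int, t0 <= t < T ->
  measurable_fun [set: n.-tuple R * p.-tuple R * q.-tuple R]
    (fun z => f t z.1.1 z.1.2 z.2)).
Context (A_meas : forall t : int, t0 <= t <= T ->
  measurable_fun [set: n.-tuple R * q.-tuple R]
    (fun z => \1_(A t z.2) z.1 : R)).

Let N := `|T - t0|%N.
Let TE : T = t0 + N%:Z.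
Proof. by rewrite /N; lia. Qed.

(* [feedback_value u k] is W_u(T - k, .). *)
Fixpoint feedback_value (u : int -> n.-tuple R -> p.-tuple R) (k : nat)
    (x : n.-tuple R) : \bar R :=
  if k is k'.+1 then
    bellman f A mu (feedback_value u k') (T - k'.+1%:Z) x
      (u (T - k'.+1%:Z) x)
  else (\int[mu]_w (\1_(A T w) x : R)%:E)%E.

Lemma feedback_value_ge0 u k x : (0 <= feedback_value u k x)%E.
Proof.
elim: k x => [|k IH] x /=; apply: integral_ge0 => w _; first by rewrite lee_fin.
by rewrite mule_ge0// lee_fin.
Qed.

Lemma measurable_indicator (t : int) : t0 <= t <= T ->
  measurable_fun [set: n.-tuple R * q.-tuple R]
    (fun z => (\1_(A t z.2) z.1 : R)%:E).
Proof. by move=> tT; apply/measurable_EFinP; exact: A_meas. Qed.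

Section fixed_feedback.
Context (u : int -> n.-tuple R -> p.-tuple R).
Context (u_meas : measurable_feedback t0 T u).

Lemma measurable_closed_loop (t : int) : t0 <= t < T ->
  measurable_fun [set: n.-tuple R * q.-tuple R]
    (fun z => f t z.1 (u t z.1) z.2).
Proof.
move=> tT.
have u_t_meas :
    measurable_fun setT (fun z : n.-tuple R * q.-tuple R => u t z.1).
  by apply: (measurableT_comp (u_meas tT)); exact: measurable_fst.
exact: (measurableT_comp (f_meas tT) (measurable_fun_pair
  (measurable_fun_pair measurable_fst u_t_meas) measurable_snd)).
Qed.

Lemma measurable_reward (t : int) (v : n.-tuple R -> \bar R) : t0 <= t < T ->
  measurable_fun setT v ->
  measurable_fun [set: n.-tuple R * q.-tuple R]
    (fun z => (\1_(A t z.2) z.1 : R)%:E * v (f t z.1 (u t z.1) z.2))%E.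
Proof.
move=> tT mv; apply: emeasurable_funM.
  by apply: measurable_indicator; lia.
by apply: (measurableT_comp mv); exact: measurable_closed_loop.
Qed.

(** Each value is a partial integral, over w, of a nonnegative function jointly measurable in (x,
    w), so Tonelli applies. The bound on k keeps the times within the range where the data are
    measurable. *)
Lemma measurable_feedback_value k : (k <= N)%N ->
  measurable_fun setT (feedback_value u k).
Proof.
elim: k => [|k IH] kN /=.
  apply: (@measurable_fun_fubini_tonelli_F _ _ _ _ _ mu
    (fun z : n.-tuple R * q.-tuple R => (\1_(A T z.2) z.1 : R)%:E)).
    by apply: measurable_indicator; lia.
  by move=> z; rewrite lee_fin.
apply: (@measurable_fun_fubini_tonelli_F _ _ _ _ _ mu
  (fun z : n.-tuple R * q.-tuple R => (\1_(A (T - k.+1%:Z) z.2) z.1 : R)%:E *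
    feedback_value u k (f (T - k.+1%:Z) z.1 (u (T - k.+1%:Z) z.1) z.2))%E).
  by apply: measurable_reward; [lia|apply: IH; lia].
by move=> z; rewrite mule_ge0 ?lee_fin ?feedback_value_ge0.
Qed.

(** * Paths and survival along a sequence of disturbances *)

Context (x0 : n.-tuple R).

Let Seq := (horizon t0 T).-tuple (q.-tuple R).
Implicit Types y : Seq.

Definition path_at y (k : nat) : n.-tuple R :=
  state_after t0 f u (at_time y) x0 k.

(** Survival strictly before time t0 + m, so the whole horizon is [alive N.+1]. The product form
    lets one factor be peeled off at a time; [aliveE] recovers the indicator of an event. *)
Definition alive (m : nat) y : R :=
  \prod_(k < m) \1_(A (t0 + k%:Z) (at_time y (t0 + k%:Z))) (path_at y k).

Lemma path_atS y k : path_at y k.+1 = f (t0 + k%:Z) (path_at y k)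
  (u (t0 + k%:Z) (path_at y k)) (at_time y (t0 + k%:Z)).
Proof. by []. Qed.

Lemma at_time_tnth y k : at_time y (t0 + k%:Z) = tnth y (inord k).
Proof. by rewrite /at_time; congr (tnth y (inord _)); lia. Qed.

(** The bounds make [inord] faithful; an index out of range would be sent to 0. *)
Lemma at_time_set_tnth y m w k : (k <= N)%N -> (m <= N)%N ->
  at_time (set_tnth y (inord m) w) (t0 + k%:Z) =
  if k == m then w else at_time y (t0 + k%:Z).
Proof.
by move=> kN mN; rewrite !at_time_tnth tnth_set_tnth -val_eqE /= !inordK.
Qed.

(** Causality: the state at step k depends only on the disturbances of index below k, so k = m is
    allowed. *)
Lemma path_at_set_tnth y m w k : (k <= m <= N)%N ->
  path_at (set_tnth y (inord m) w) k = path_at y k.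
Proof.
rewrite /path_at; elim: k => //= k IH kmN; rewrite IH; last by lia.
by rewrite at_time_set_tnth; [case: eqP => //; lia|lia|lia].
Qed.

Lemma alive_set_tnth y m w : (m <= N)%N ->
  alive m (set_tnth y (inord m) w) = alive m y.
Proof.
move=> mN; apply: eq_bigr => -[k /= km] _.
rewrite path_at_set_tnth; last by lia.
by rewrite at_time_set_tnth; [case: eqP => //; lia|lia|lia].
Qed.

Lemma aliveS y m :
  alive m.+1 y =
  alive m y * \1_(A (t0 + m%:Z) (at_time y (t0 + m%:Z))) (path_at y m).
Proof. exact: big_ord_recr. Qed.

Lemma alive_ge0 m y : 0 <= alive m y.
Proof. exact: prodr_ge0. Qed.

Lemma aliveE m y : alive m y = \1_[set y | forall k, (k < m)%N ->
  A (t0 + k%:Z) (at_time y (t0 + k%:Z)) (path_at y k)] y.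
Proof.
elim: m => [|m IH].
  by rewrite /alive big_ord0 indicE mem_set.
rewrite aliveS IH !indicE -natrM mulnb; congr ((_ : bool)%:R).
apply/andP/idP => [[/set_mem/= ym /set_mem yA]|/set_mem/= yS].
  by apply/mem_set => k /=; rewrite ltnS leq_eqVlt => /predU1P[->//|/ym].
by split; [apply/mem_set => k km|apply/mem_set]; apply: yS => //; exact: ltnW.
Qed.

Lemma measurable_path_at k : (k <= N)%N ->
  measurable_fun [set: Seq] (path_at ^~ k).
Proof.
rewrite /path_at; elim: k => [|k IH] kN /=; first exact: measurable_cst.
have tT : t0 <= t0 + k%:Z < T by lia.
have mk : measurable_fun [set: Seq] (fun y => tnth y (inord k)).
  exact: measurable_tnth.
under eq_fun do rewrite at_time_tnth.
exact: (measurableT_comp (measurable_closed_loop tT)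
  (measurable_fun_pair (IH (ltnW kN)) mk)).
Qed.

Lemma measurable_alive m : (m <= N.+1)%N -> measurable_fun [set: Seq] (alive m).
Proof.
elim: m => [|m IH] mN.
  rewrite (_ : alive 0 = cst 1); first exact: measurable_cst.
  by apply/funext => y; rewrite /alive big_ord0.
have tT : t0 <= t0 + m%:Z <= T by lia.
have mm : measurable_fun [set: Seq] (fun y => tnth y (inord m)).
  exact: measurable_tnth.
rewrite (_ : alive m.+1 = alive m \* (fun y =>
  \1_(A (t0 + m%:Z) (tnth y (inord m))) (path_at y m))); last first.
  by apply/funext => y; rewrite aliveS at_time_tnth.
apply: measurable_funM; first by apply: IH; lia.
exact: (measurableT_comp (A_meas tT)
  (measurable_fun_pair (measurable_path_at mN) mm)).
Qed.

(** * Conservation of expected survival times value under the product law *)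

Section law.
Context (nu : probability Seq R).
Context (nuE : forall E : 'I_(horizon t0 T) -> set (q.-tuple R),
  (forall i, measurable (E i)) ->
  nu (tuple_box E) = (\prod_(i < horizon t0 T) mu (E i))%E).

(** From m to m + 1, redraw coordinate m. By causality [alive m] and the state at step m do not see
    it, so the survival factor leaves the inner integral, and what remains is the one-step recursion
    of W_u. *)
Lemma integral_alive_feedback_value m : (m <= N)%N ->
  (\int[nu]_y ((alive m y)%:E * feedback_value u (N - m) (path_at y m)) =
   feedback_value u N x0)%E.
Proof.
elim: m => [|m IH] mN.
  transitivity (\int[nu]_y (cst (feedback_value u N x0) y))%E.
    by apply: eq_integral => y _; rewrite /alive big_ord0 mul1e subn0.
  by rewrite integral_cst// [X in (_ * X)%E]probability_setT mule1.
have mN' := ltnW mN.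
have tT : t0 <= t0 + m%:Z < T by lia.
rewrite -IH// (integral_set_tnth nuE (inord m)); last 2 first.
- apply: emeasurable_funM.
    by apply/measurable_EFinP; apply: measurable_alive; lia.
  apply: (measurableT_comp (measurable_feedback_value _)); first by lia.
  exact: measurable_path_at.
- by move=> y; rewrite mule_ge0 ?lee_fin ?alive_ge0 ?feedback_value_ge0.
apply: eq_integral => y _.
have mr := measurable_reward tT
  (measurable_feedback_value (leq_subr m.+1 N)).
transitivity (\int[mu]_w ((alive m y)%:E *
    ((\1_(A (t0 + m%:Z) w) (path_at y m) : R)%:E *
     feedback_value u (N - m.+1) (f (t0 + m%:Z) (path_at y m)
       (u (t0 + m%:Z) (path_at y m)) w))))%E.
  apply: eq_integral => w _.
  have wE : at_time (set_tnth y (inord m) w) (t0 + m%:Z) = w.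
    by rewrite at_time_set_tnth// eqxx.
  have xE : path_at (set_tnth y (inord m) w) m = path_at y m.
    by rewrite path_at_set_tnth// leqnn.
  by rewrite aliveS (alive_set_tnth _ _ mN') path_atS xE wE EFinM -muleA.
rewrite ge0_integralZl//; last 3 first.
- exact: (measurable_fun_pair2 _ mr).
- by move=> w _; rewrite mule_ge0 ?lee_fin ?feedback_value_ge0.
- by rewrite lee_fin alive_ge0.
(* [feedback_value] counts time backwards: with N - m steps to go, the time is t0 + m. *)
rewrite (_ : (N - m)%N = (N - m.+1).+1)/=; last by lia.
by rewrite /bellman (_ : T - (N - m.+1).+1%:Z = t0 + m%:Z)//; lia.
Qed.

(** At m = N the terminal value W_u(T, x(T)) is still an expectation over a fresh w(T). One more
    redraw, at index N, identifies it with the last survival factor. *)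
Lemma integral_alive :
  (\int[nu]_y (alive N.+1 y)%:E = feedback_value u N x0)%E.
Proof.
rewrite -(integral_alive_feedback_value (leqnn N)) subnn.
rewrite (integral_set_tnth nuE (inord N)); last 2 first.
- by apply/measurable_EFinP; exact: measurable_alive.
- by move=> y; rewrite lee_fin alive_ge0.
apply: eq_integral => y _ /=.
transitivity (\int[mu]_w ((alive N y)%:E *
    (\1_(A T w) (path_at y N) : R)%:E))%E.
  apply: eq_integral => w _.
  rewrite aliveS (alive_set_tnth _ _ (leqnn N)) path_at_set_tnth ?leqnn//.
  by rewrite at_time_set_tnth// eqxx EFinM -TE.
rewrite ge0_integralZl//.
- apply: (measurable_fun_pair2 (path_at y N) (measurable_indicator _)).
  by lia.
- by rewrite lee_fin alive_ge0.
Qed.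

End law.

End fixed_feedback.

(** * Comparison of the feedback values with V *)

Lemma optimal_feedback_value u k x : measurable_feedback t0 T u ->
  optimal_feedback t0 T f B A mu u -> (k <= N)%N ->
  feedback_value u k x = value_to_go T f B A mu k x.
Proof.
move=> u_meas u_opt.
elim: k x => [|k IH] x kN; first by rewrite /= unlock.
have tT : t0 <= T - k.+1%:Z < T by lia.
(* The optimal control attains the supremum, so W_u and V obey the same recursion. *)
have [_] := u_opt _ x tT.
rewrite /V (_ : absz (T - (T - k.+1%:Z))%R = k.+1); last by lia.
rewrite (_ : absz (T - (T - k.+1%:Z + 1))%R = k) => [<-|]; last by lia.
rewrite /= (_ : feedback_value u k = value_to_go T f B A mu k)//.
by apply/funext => z; rewrite IH// ltnW.
Qed.

(** The Bellman expectation is monotone in the next value, which handles the induction; the supremum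
    over B then dominates the control chosen by [u]. *)
Lemma feedback_value_le u ustar k x :
  admissible_feedback t0 T B u -> measurable_feedback t0 T ustar ->
  optimal_feedback t0 T f B A mu ustar -> (k <= N)%N ->
  (feedback_value u k x <= value_to_go T f B A mu k x)%E.
Proof.
move=> [u_meas uB] ustar_meas ustar_opt.
elim: k x => [|k IH] x kN; first by rewrite /= unlock.
have tT : t0 <= T - k.+1%:Z < T by lia.
(* Seeing V as the value of [ustar] provides the measurability required to compare the integrals. *)
have valueE : feedback_value ustar k = value_to_go T f B A mu k.
  by apply/funext => z; apply: optimal_feedback_value => //; exact: ltnW.
apply: (@le_trans _ _ (bellman f A mu (value_to_go T f B A mu k)
  (T - k.+1%:Z) x (u (T - k.+1%:Z) x))); last first.
  by apply: ereal_sup_ubound; exists (u (T - k.+1%:Z) x) => //; exact: uB.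
rewrite -valueE; apply: ge0_le_integral => //.
- by move=> w _; rewrite mule_ge0 ?lee_fin ?feedback_value_ge0.
- apply: (measurable_fun_pair2 x (measurable_reward u_meas tT _)).
  by apply: measurable_feedback_value => //; exact: ltnW.
- apply: (measurable_fun_pair2 x (measurable_reward u_meas tT _)).
  by apply: measurable_feedback_value => //; exact: ltnW.
- by move=> w _; rewrite valueE lee_wpmul2l ?lee_fin ?IH// ltnW.
Qed.

(** * Transfer from the trace space of scenarios to sequences *)

Section scenario_law.
Context (S : int -> set (q.-tuple R)) (S0 : Omega t0 T S !=set0).
Context (P : probability (scenario S0) R).
Context (P_iid : iid P mu).

Lemma measurable_Omega_val :
  measurable_fun [set: scenario S0] (@Omega_val R q t0 T S S0).
Proof. by move=> _ Y mY; exists Y. Qed.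

HB.instance Definition _ :=
  isMeasurableFun.Build _ _ _ _ (@Omega_val R q t0 T S S0 : scenario S0 -> _)
    measurable_Omega_val.

Lemma probability_viable u x0 : measurable_feedback t0 T u ->
  P (viable_scenarios f A (S0 := S0) u x0) = feedback_value u N x0.
Proof.
move=> u_meas.
(* Pushing P forward along the inclusion of Omega gives a law on all sequences, where any coordinate
   may be overwritten without leaving the space. *)
pose nu := distribution P (@Omega_val R q t0 T S S0 : {mfun scenario S0 >-> _}).
have nuE (E : 'I_(horizon t0 T) -> set (q.-tuple R)) :
    (forall i, measurable (E i)) ->
    nu (tuple_box E) = (\prod_(i < horizon t0 T) mu (E i))%E.
  move=> mE; rewrite -(P_iid mE); congr (P _).
  apply/seteqP; split => w /= wE i; have := wE i;
    by rewrite /Defs.coord at_time_tnth inord_val.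
pose C : set ((horizon t0 T).-tuple (q.-tuple R)) :=
  [set y | forall k, (k < N.+1)%N ->
    A (t0 + k%:Z) (at_time y (t0 + k%:Z)) (path_at u x0 y k)].
have mC : measurable C.
  by apply/(@measurable_indicP _ _ R); rewrite (_ : \1_C = alive u x0 N.+1);
    [exact: measurable_alive|apply/funext => y; rewrite aliveE].
(* Integer times t in {t0, ..., T} correspond to offsets k = t - t0 with k < N + 1. *)
have -> : viable_scenarios f A (S0 := S0) u x0 =
    @Omega_val R q t0 T S S0 @^-1` C.
  apply/seteqP; split => w /= wA.
    move=> k kN; have := wA (t0 + k%:Z).
    rewrite /state_path (_ : `|_|%N = k); last by lia.
    by apply; lia.
  move=> t tT; have := wA `|t - t0|%N.
  rewrite (_ : t0 + `|t - t0|%N%:Z = t); last by lia.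
  by apply; lia.
rewrite -(integral_alive u_meas x0 nuE).
under eq_integral do rewrite aliveE.
by rewrite integral_indic// setIT.
Qed.

End scenario_law.

End feedback.

Theorem proposition2 (R : realType) (n p q : nat) (t0 T : int) (ht : t0 < T)
  (f : int -> n.-tuple R -> p.-tuple R -> q.-tuple R -> n.-tuple R)
  (B : int -> n.-tuple R -> set (p.-tuple R))
  (A : int -> q.-tuple R -> set (n.-tuple R))
  (S : int -> set (q.-tuple R)) (S0 : Omega t0 T S !=set0)
  (B_neq0 : forall (t : int) x, t0 <= t < T -> B t x !=set0)
  (A_neq0 : forall (t : int) w, t0 <= t <= T -> A t w !=set0)
  (P : probability (scenario S0) R) (mu : probability (q.-tuple R) R)
  (P_iid : iid P mu)
  (f_meas : forall t : int, t0 <= t < T ->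
     measurable_fun [set: n.-tuple R * p.-tuple R * q.-tuple R]
       (fun z => f t z.1.1 z.1.2 z.2))
  (A_meas : forall t : int, t0 <= t <= T ->
     measurable_fun [set: n.-tuple R * q.-tuple R]
       (fun z => \1_(A t z.2) z.1 : R))
  (V_max : maximum_attained t0 T f B A mu)
  (V_meas : forall t : int, t0 <= t <= T ->
     measurable_fun [set: n.-tuple R] (V T f B A mu t))
  (ustar : int -> n.-tuple R -> p.-tuple R)
  (ustar_meas : measurable_feedback t0 T ustar)
  (ustar_opt : optimal_feedback t0 T f B A mu ustar)
  (x0 : n.-tuple R) (beta : R) (beta_gt0 : 0 < beta) (beta_le1 : beta <= 1) :
  (beta%:E <= V T f B A mu t0 x0)%E <-> viability_kernel f B A P beta x0.
Proof.
have t0T : t0 <= T := ltW ht.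
have u_opt_adm : admissible_feedback t0 T B ustar.
  by split=> // t x /(ustar_opt t x)[].
rewrite /V; split => [beta_le|[u u_adm]].
  exists ustar => //.
  rewrite (probability_viable t0T f_meas A_meas P_iid _ ustar_meas).
  by rewrite (optimal_feedback_value t0T _ ustar_meas ustar_opt).
rewrite (probability_viable t0T f_meas A_meas P_iid _ u_adm.1).
(* Any feedback witnessing membership in the kernel has value at least [beta], and V dominates
   it. *)
move=> /le_trans; apply.
exact: (feedback_value_le t0T f_meas A_meas x0 u_adm ustar_meas ustar_opt
  (leqnn _)).
Qed.
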